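(* For any marked conic $(X,L,o)$, the induced binary operation $\oplus$ makes $X_L$ into a group with identity element $o$.
   Context: Everything takes place in the real projective plane $\mathbb{RP}^2$. For points $x,y$ on a conic $X$, $\overline{xy}$ denotes the line through $x$ and $y$ if $x\neq y$, and the tangent line to $X$ at $x$ if $x=y$; for distinct points not both on $X$ it is the line through them. A marked conic is a triple $(X,L,o)$ where $X$ is a nondegenerate conic in $\mathbb{RP}^2$, $L$ is a line in $\mathbb{RP}^2$, and $o$ is a point of $X$ not on $L$. Put $X_L:=X\setminus L$. The induced binary operation $\oplus$ on $X_L$ is: for $a,b\in X_L$, let $p$ be the point where $\overline{ab}$ meets $L$ (it does not lie on $X$); the line $\overline{op}$ meets $X$ in two points counted with multiplicity, one of which is $o$; $a\oplus b$ is the other one (so $a\oplus b=o$ if $\overline{op}$ is tangent to $X$ at $o$). *)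

(* Defs.v *)
From HB Require Import structures.
From mathcomp Require Import all_boot all_order all_algebra.
From mathcomp Require Import boolp classical_sets reals.

Set Implicit Arguments.
Unset Strict Implicit.
Unset Printing Implicit Defensive.

Import GRing.Theory Num.Theory.

Local Open Scope classical_set_scope.
Local Open Scope ring_scope.

(* Points and lines of RP^2 are the subspaces of dimension 1 and 2 of R^3;
   incidence is inclusion, the join of two points is the sum of subspaces and
   the meet of two lines is their intersection. *)
Record point (R : realType) := Point {
  point_space :> {vspace 'rV[R]_3};
  _ : \dim point_space == 1%N }.

HB.instance Definition _ (R : realType) := [isSub for @point_space R].
HB.instance Definition _ (R : realType) := [Choice of point R by <:].

Record line (R : realType) := Line {
  line_space :> {vspace 'rV[R]_3};
  _ : \dim line_space == 2%N }.

HB.instance Definition _ (R : realType) := [isSub for @line_space R].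
HB.instance Definition _ (R : realType) := [Choice of line R by <:].

Definition on_line (R : realType) (x : point R) (l : line R) : bool :=
  (x <= l)%VS.

(* A nondegenerate conic is given by a nondegenerate quadratic form on R^3,
   i.e. by an invertible symmetric matrix. *)
Record conic (R : realType) := Conic {
  conic_mx : 'M[R]_3;
  _ : conic_mx^T = conic_mx;
  _ : conic_mx \in unitmx }.

Definition conic_bilin (R : realType) (X : conic R) (u v : 'rV[R]_3) : R :=
  (u *m conic_mx X *m v^T) 0 0.

Definition conic_form (R : realType) (X : conic R) (v : 'rV[R]_3) : R :=
  conic_bilin X v v.

Definition conic_points (R : realType) (X : conic R) : set (point R) :=
  [set x | forall v, v \in point_space x -> conic_form X v = 0].

(* The differential of conic_form X at u is v |-> 2 * conic_bilin X u v, so the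
   tangent line at a point of the conic is the kernel of conic_bilin X u, for u
   spanning that point. *)
Definition tangent (R : realType) (X : conic R) (x : point R) (l : line R) :
    Prop :=
  forall u v, u \in point_space x -> v \in line_space l ->
    conic_bilin X u v = 0.

Definition chord (R : realType) (X : conic R) (x y : point R) (l : line R) :
    Prop :=
  if x == y then tangent X x l else (x + y)%VS = l.

(* The intersection of l and X, counted with multiplicity, is {x, y}: the
   restriction to l of the quadratic form of X is the product of two nonzero
   linear forms on l, one vanishing at x and the other at y. *)
Definition meets_in (R : realType) (X : conic R) (l : line R) (x y : point R) :
    Prop :=
  exists f g : 'Hom('rV[R]_3, R^o),
    [/\ forall v, v \in line_space l -> conic_form X v = f v * g v,
        (l :&: lker f)%VS = x
      & (l :&: lker g)%VS = y].

Record marked_conic (R : realType) := MarkedConic {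
  mc_conic : conic R;
  mc_line : line R;
  mc_base : point R;
  _ : conic_points mc_conic mc_base;
  _ : ~~ on_line mc_base mc_line }.

Definition XL (R : realType) (M : marked_conic R) : set (point R) :=
  conic_points (mc_conic M) `\` [set x | on_line x (mc_line M)].

Lemma mc_base_XL (R : realType) (M : marked_conic R) : mc_base M \in XL M.
Proof. by case: M => X L o oX oL; rewrite inE; split=> //=; apply/negP. Qed.

Definition base_pt (R : realType) (M : marked_conic R) : XL M :=
  SigSub (mc_base_XL M).

Definition induced_sum (R : realType) (M : marked_conic R) (a b c : XL M) :
    Prop :=
  exists (l m : line R) (p : point R),
    [/\ chord (mc_conic M) (val a) (val b) l,
        (l :&: mc_line M)%VS = p,
        (mc_base M + p)%VS = m
      & meets_in (mc_conic M) m (mc_base M) (val c)].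

(* xget returns the point base_pt M if no c satisfies induced_sum a b c. *)
Definition oplus (R : realType) (M : marked_conic R) (a b : XL M) : XL M :=
  xget (base_pt M) [set c | induced_sum a b c].

Definition is_group (T : Type) (op : T -> T -> T) (e : T) : Prop :=
  [/\ associative op, left_id e op, right_id e op
    & exists inv : T -> T, left_inverse e inv op /\ right_inverse e inv op].

(* Main.v *)
Require Import Defs.
From mathcomp Require Import all_boot all_order all_algebra.
From mathcomp Require Import boolp classical_sets reals.
From mathcomp Require Import ring.

Set Implicit Arguments.
Unset Strict Implicit.
Unset Printing Implicit Defensive.

Import Order.TTheory GRing.Theory Num.Theory.
Import Defs.

Local Open Scope ring_scope.

(** The idea is that X_L is the multiplicative group of a quadratic algebra
modulo scalars, so that the group axioms are inherited from an algebra.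

Choose a basis u, e, w of R^3 with u spanning the base point o, in which the
conic is y^2 = x z; as o is not on L, the line L has an equation
x + al y + be z = 0 (exists_adapted_frame).  The map
  (s, t) |-> (s^2, s t, t^2)                                         (param)
identifies the projective line with the conic, o being the image of (1, 0), and
the image of (s, t) is on L exactly when s^2 + al s t + be t^2 vanishes.  That
form is the norm of s + t xi in A = R[xi] / (xi^2 - al xi + be), so the points
of X_L are the invertible elements of A up to scalars (represented,
representing, represents_inj).

The line through the images of q = (s, t) and q' = (s', t'), or the tangent when
they coincide, has the equation
  t t' x - (s t' + s' t) y + s s' z = 0                              (chordP).
Subtracting t t' times the equation of L leaves
  - (s t' + s' t + al t t') y + (s s' - be t t') z = 0,
which is the equation of the chord through o and the point with parameter q q',
the product being taken in A.  Both chords therefore meet L in the same point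
(meet_line_base_chord), which says that the sum of the points with parameters q
and q' is the point with parameter q q' (induced_sumP). *)

(** * Points and lines of the projective plane *)

Lemma dim_point (R : realType) (x : point R) : \dim x = 1%N.
Proof. by case: x => V /= /eqP. Qed.

Lemma dim_line (R : realType) (l : line R) : \dim l = 2%N.
Proof. by case: l => V /= /eqP. Qed.

Lemma point_span (R : realType) (x : point R) (v : 'rV[R]_3) :
  v \in point_space x -> v != 0 -> point_space x = <[v]>%VS.
Proof.
move=> vx v0; apply/esym/eqP.
by rewrite eqEdim -memvE vx dim_vline v0 dim_point.
Qed.

Lemma point_gen (R : realType) (x : point R) :
  exists2 v : 'rV[R]_3, v != 0 & point_space x = <[v]>%VS.
Proof.
have v0 : vpick (point_space x) != 0 by rewrite vpick0 -dimv_eq0 dim_point.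
exists (vpick (point_space x)) => //; apply: point_span v0; exact: memv_pick.
Qed.

Lemma point_inj (R : realType) (x y : point R) :
  (point_space x <= point_space y)%VS -> x = y.
Proof.
by move=> xy; apply/val_inj/eqP; rewrite eqEdim xy /= !dim_point.
Qed.

Lemma dim_join (R : realType) (x y : point R) :
  x != y -> \dim (x + y)%VS = 2%N.
Proof.
move=> xy; rewrite dimv_disjoint_sum ?dim_point //.
apply/eqP; rewrite -dimv_eq0 -leqn0 leqNgt; apply/negP => h; case/eqP: xy.
have /eqP e : (x :&: y == x)%VS by rewrite eqEdim capvSl dim_point.
by apply: point_inj; rewrite -e capvSr.
Qed.

Lemma sub_line_eq (R : realType) (l m : line R) :
  (line_space l <= line_space m)%VS -> l = m.
Proof.
by move=> lm; apply/val_inj/eqP; rewrite eqEdim lm /= !dim_line.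
Qed.

Lemma meet_lines (R : realType) (l m : line R) :
  l != m -> \dim (l :&: m)%VS = 1%N.
Proof.
move=> lm; have /eqP := dimv_sum_cap (line_space l) (line_space m).
rewrite !dim_line.
have h3 : (\dim (l + m)%VS <= 3)%N.
  by rewrite (leq_trans (dimvS (subvf _))) // dimvf dim_matrix.
have h2 : (2 < \dim (l + m)%VS)%N.
  rewrite ltnNge; apply/negP => h; case/eqP: lm.
  have /eqP e : (line_space m == l + m)%VS.
    by rewrite eqEdim addvSr dim_line.
  by apply: sub_line_eq; rewrite e addvSl.
have -> : \dim (l + m)%VS = 3%N by apply/eqP; rewrite eqn_leq h3 h2.
by move/eqP => [].
Qed.

Lemma dim_lker (R : realType) (f : 'Hom('rV[R]_3, R^o)) (v : 'rV[R]_3) :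
  f v != 0 -> \dim (lker f) = 2%N.
Proof.
move=> fv; have := limg_ker_dim f fullv; rewrite capfv dimvf dim_matrix.
have -> : \dim (limg f) = 1%N; last by rewrite addn1 => -[].
apply/eqP; rewrite eqn_leq; apply/andP; split.
  by apply: (leq_trans (dimvS (subvf _))); rewrite dimvf.
rewrite lt0n dimv_eq0; apply: contra fv => /eqP e.
by rewrite -memv0 -e memv_img ?memvf.
Qed.

Lemma meet_lker (R : realType) (m : line R) (x : point R)
    (f : 'Hom('rV[R]_3, R^o)) (v : 'rV[R]_3) :
    v \in line_space m -> f v != 0 -> on_line x m -> (x <= lker f)%VS ->
  (m :&: lker f)%VS = x.
Proof.
move=> vm fv xm xf; apply/esym/eqP; rewrite eqEdim subv_cap [(x <= m)%VS]xm xf /=.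
rewrite dim_point -ltnS ltnNge; apply/negP => h.
have /eqP e : (m :&: lker f == m)%VS by rewrite eqEdim capvSl dim_line.
by move: vm; rewrite -e memv_cap memv_ker (negPf fv) andbF.
Qed.

(** * The bilinear form of a conic *)

Lemma conic_bilinDl (R : realType) (X : conic R) u v w :
  conic_bilin X (u + v) w = conic_bilin X u w + conic_bilin X v w.
Proof. by rewrite /conic_bilin !mulmxDl mxE. Qed.

Lemma conic_bilinZl (R : realType) (X : conic R) k u v :
  conic_bilin X (k *: u) v = k * conic_bilin X u v.
Proof. by rewrite /conic_bilin -!scalemxAl mxE. Qed.

Lemma conic_bilinC (R : realType) (X : conic R) u v :
  conic_bilin X u v = conic_bilin X v u.
Proof.
case: X => S symS unitS; rewrite /conic_bilin /=.
transitivity ((u *m S *m v^T)^T 0 0); first by rewrite [RHS]mxE.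
by rewrite !trmx_mul trmxK symS mulmxA.
Qed.

Lemma conic_bilinDr (R : realType) (X : conic R) u v w :
  conic_bilin X u (v + w) = conic_bilin X u v + conic_bilin X u w.
Proof. by rewrite conic_bilinC conic_bilinDl !(conic_bilinC X u). Qed.

Lemma conic_bilinZr (R : realType) (X : conic R) k u v :
  conic_bilin X u (k *: v) = k * conic_bilin X u v.
Proof. by rewrite conic_bilinC conic_bilinZl conic_bilinC. Qed.

Lemma conic_bilin_nondeg (R : realType) (X : conic R) u :
  (forall v, conic_bilin X u v = 0) -> u = 0.
Proof.
case: X => S symS unitS; rewrite /conic_bilin /= => h.
apply: (can_inj (mulmxK unitS)); rewrite mul0mx; apply/rowP => j.
have := h (delta_mx 0 j); rewrite trmx_delta -colE.
by rewrite !mxE.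
Qed.

(** Two linear conditions on three unknowns have a nonzero solution. *)
Lemma conic_orthogonal (R : realType) (X : conic R) (u w : 'rV[R]_3) :
  exists e, [/\ e != 0, conic_bilin X u e = 0 & conic_bilin X w e = 0].
Proof.
pose A : 'M[R]_(3, 1 + 1) :=
  row_mx ((u *m conic_mx X)^T) ((w *m conic_mx X)^T).
have ker0 : kermx A != 0.
  rewrite -mxrank_eq0 mxrank_ker -lt0n subn_gt0.
  exact: leq_ltn_trans (rank_leq_col A) _.
exists (nz_row (kermx A)); split; first by rewrite nz_row_eq0.
all: have /sub_kermxP := nz_row_sub (kermx A).
all: rewrite mul_mx_row -(row_mx0 R 1 1 1) => /eq_row_mx[hu hw].
all: rewrite /conic_bilin.
- transitivity ((nz_row (kermx A) *m (u *m conic_mx X)^T)^T 0 0).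
    by rewrite trmx_mul trmxK.
  by rewrite hu !mxE.
- transitivity ((nz_row (kermx A) *m (w *m conic_mx X)^T)^T 0 0).
    by rewrite trmx_mul trmxK.
  by rewrite hw !mxE.
Qed.

(** * Coordinates adapted to a marked conic *)

Definition lincomb (R : realType) (u e w : 'rV[R]_3) (x y z : R) :=
  x *: u + y *: e + z *: w.

Lemma conic_bilin_lincomb (R : realType) (X : conic R) u e w x y z v :
  conic_bilin X (lincomb u e w x y z) v =
  x * conic_bilin X u v + y * conic_bilin X e v + z * conic_bilin X w v.
Proof. by rewrite !conic_bilinDl !conic_bilinZl. Qed.

(** The vectors u and w span a hyperbolic plane and e is orthogonal to it.
Pairing a linear relation with w and with u kills its coefficients on u and on
w, so the three vectors are independent and the coordinates exist; e cannot then
be isotropic, since it would be orthogonal to a basis. *)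
Lemma hyperbolic_frame (R : realType) (X : conic R) (u e w : 'rV[R]_3) :
    conic_form X u = 0 -> conic_form X w = 0 -> conic_bilin X u w != 0 ->
    e != 0 -> conic_bilin X u e = 0 -> conic_bilin X w e = 0 ->
  conic_form X e != 0 /\
  exists x y z : 'Hom('rV[R]_3, R^o),
    (forall v, lincomb u e w (x v) (y v) (z v) = v) /\
    (forall a b c, [/\ x (lincomb u e w a b c) = a,
                       y (lincomb u e w a b c) = b
                     & z (lincomb u e w a b c) = c]).
Proof.
rewrite /conic_form => uu ww uw e0 ue we.
pose b := [tuple u; e; w].
have bE k : \sum_(i < 3) k i *: b`_i = lincomb u e w (k 0) (k 1) (k 2%:R).
  rewrite !big_ord_recr big_ord0 /= add0r /lincomb.
  by congr (k _ *: _ + k _ *: _ + k _ *: _); apply: val_inj.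
have indep x y z : lincomb u e w x y z = 0 -> [/\ x = 0, y = 0 & z = 0].
  move=> h; have Bh v : conic_bilin X (lincomb u e w x y z) v = 0.
    by rewrite h -(scale0r 0) conic_bilinZl mul0r.
  have x0 : x = 0.
    have /eqP := Bh w; rewrite conic_bilin_lincomb ww (conic_bilinC X e) we.
    by rewrite !mulr0 !addr0 mulf_eq0 (negPf uw) orbF => /eqP.
  have z0 : z = 0.
    have /eqP := Bh u; rewrite conic_bilin_lincomb uu (conic_bilinC X e) ue.
    rewrite (conic_bilinC X w).
    by rewrite !mulr0 !add0r mulf_eq0 (negPf uw) orbF => /eqP.
  split=> //; move/eqP: h; rewrite /lincomb x0 z0 !scale0r add0r addr0.
  by rewrite scaler_eq0 (negPf e0) orbF => /eqP.
have freeb : free b.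
  apply/freeP => k; rewrite bE => /indep[k0 k1 k2].
  by case=> -[|[|[|//]]] i3; [rewrite -[RHS]k0|rewrite -[RHS]k1|rewrite -[RHS]k2];
    congr k; apply: val_inj.
have basisb : basis_of fullv b.
  by rewrite basisEfree freeb subvf dimvf dim_matrix.
have spanb v : lincomb u e w (coord b 0 v) (coord b 1 v) (coord b 2%:R v) = v.
  by rewrite -(bE (fun i => coord b i v)) -(coord_basis basisb (memvf v)).
have coordb i x y z :
    coord b i (lincomb u e w x y z) = [:: x; y; z]`_i.
  have := bE (fun i : 'I_3 => [:: x; y; z]`_i) => /= <-.
  by rewrite coord_sum_free.
split.
  apply: contra e0 => /eqP ee; apply/eqP/(@conic_bilin_nondeg _ X) => v.
  by rewrite conic_bilinC -(spanb v) conic_bilin_lincomb ue we ee !mulr0 !addr0.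
pose coordf i : 'Hom('rV[R]_3, R^o) := linfun (coord b i : 'rV[R]_3 -> R^o).
exists (coordf 0), (coordf 1), (coordf 2%:R).
by split=> [v|x y z]; rewrite !lfunE /= ?spanb // !coordb.
Qed.

(** A basis u, e, w in which the conic is y^2 = x z, the base point is [1 : 0 : 0]
and the line is x + alpha y + beta z = 0, together with the coordinates x, y, z
in that basis.  The factor d is needed because a given quadratic form can only
be brought to the form y^2 - x z up to a scalar. *)
Record adapted_frame (R : realType) (M : marked_conic R) := AdaptedFrame {
  af_u : 'rV[R]_3;
  af_e : 'rV[R]_3;
  af_w : 'rV[R]_3;
  af_x : 'Hom('rV[R]_3, R^o);
  af_y : 'Hom('rV[R]_3, R^o);
  af_z : 'Hom('rV[R]_3, R^o);
  af_d : R;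
  af_alpha : R;
  af_beta : R;
  af_vec := lincomb af_u af_e af_w;
  af_coordK : forall v, af_vec (af_x v) (af_y v) (af_z v) = v;
  af_vecK : forall a b c, [/\ af_x (af_vec a b c) = a,
    af_y (af_vec a b c) = b & af_z (af_vec a b c) = c];
  af_d_neq0 : af_d != 0;
  af_bilinE : forall a b c a' b' c',
    conic_bilin (mc_conic M) (af_vec a b c) (af_vec a' b' c') =
    af_d * (2 * b * b' - a * c' - c * a');
  af_baseE : point_space (mc_base M) = <[af_u]>%VS;
  af_lineE : forall a b c, (af_vec a b c \in line_space (mc_line M)) =
    (a + af_alpha * b + af_beta * c == 0) }.

(** Any line through o other than the tangent meets the conic again; w is a
multiple of that second isotropic vector, and e is the pole of the line through
o and w.  The factor of w is chosen to make the value of the form at e twice the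
opposite of the pairing of u and w.  The plane L is complementary to u, and
alpha and beta are the components of e and w along u in this decomposition. *)
Lemma exists_adapted_frame (R : realType) (M : marked_conic R) :
  inhabited (adapted_frame M).
Proof.
case: M => X L o oX oL.
have [u u0 oE] := point_gen o.
have uu : conic_form X u = 0 by apply: oX; rewrite oE memv_line.
have [v uv] : exists v, conic_bilin X u v != 0.
  apply: contrapT => h; case/eqP: u0; apply: (@conic_bilin_nondeg _ X) => v.
  by apply/eqP; apply: contrapT => /negP hv; apply: h; exists v.
(* The coefficient of u makes w1 isotropic. *)
pose w1 := v + (- (conic_form X v / (2 * conic_bilin X u v))) *: u.
have uw1 : conic_bilin X u w1 = conic_bilin X u v.
  by rewrite /w1 conic_bilinDr conic_bilinZr [conic_bilin X u u]uu mulr0 addr0.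
have w1w1 : conic_form X w1 = 0.
  rewrite /conic_form {1}/w1 conic_bilinDl conic_bilinZl uw1.
  rewrite /w1 conic_bilinDr conic_bilinZr (conic_bilinC X v u) -/(conic_form X v).
  by field.
have [e [e0 ue w1e]] := conic_orthogonal X u w1.
have uw1_neq0 : conic_bilin X u w1 != 0 by rewrite uw1.
have [ee _] := hyperbolic_frame uu w1w1 uw1_neq0 e0 ue w1e.
pose d := conic_form X e / 2.
have d0 : d != 0 by rewrite mulf_neq0 ?invr_eq0 ?pnatr_eq0.
pose k := - d / conic_bilin X u v.
pose w := k *: w1.
have uw : conic_bilin X u w = - d by rewrite conic_bilinZr uw1 /k; field.
have ww : conic_form X w = 0.
  by rewrite /conic_form conic_bilinZl conic_bilinZr [conic_bilin _ _ _]w1w1 !mulr0.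
have we : conic_bilin X w e = 0 by rewrite conic_bilinZl w1e mulr0.
have uw_neq0 : conic_bilin X u w != 0 by rewrite uw oppr_eq0.
have [_ [x [y [z [coordK vecK]]]]] := hyperbolic_frame uu ww uw_neq0 e0 ue we.
have uL : u \notin line_space L.
  by apply: contra oL; rewrite /on_line oE -memvE.
have fullE : (<[u]> + line_space L)%VS = fullv.
  apply/eqP; rewrite eqEdim subvf dimvf dim_matrix dimv_disjoint_sum.
    by rewrite dim_vline u0 dim_line.
  apply/eqP; rewrite -subv0; apply/subvP => _ /memv_capP[/vlineP[c ->]].
  by rewrite rpredZeq (negPf uL) orbF => /eqP ->; rewrite scale0r mem0v.
have project v' : exists a, v' - a *: u \in line_space L.
  have : v' \in (<[u]> + line_space L)%VS by rewrite fullE memvf.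
  case/memv_addP => _ /vlineP[a ->] [l lL ->]; exists a.
  by rewrite addrC addKr.
have [al eL] := project e; have [be wL] := project w.
suff F : adapted_frame (MarkedConic oX oL) by exact: inhabits.
refine (@AdaptedFrame R (MarkedConic oX oL) u e w x y z d al be
          coordK vecK d0 _ oE _).
  move=> a b c a' b' c'; rewrite conic_bilin_lincomb.
  rewrite !(conic_bilinC _ _ (lincomb _ _ _ _ _ _)) !conic_bilin_lincomb /=.
  rewrite (conic_bilinC X e u) (conic_bilinC X w u) (conic_bilinC X e w).
  rewrite [conic_bilin X u u]uu [conic_bilin X w w]ww ue we uw.
  have -> : conic_bilin X e e = 2 * d by rewrite /d /conic_form; field.
  by ring.
move=> a b c /=.
have -> : lincomb u e w a b c = (a + al * b + be * c) *: u
    + (b *: (e - al *: u) + c *: (w - be *: u)).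
  rewrite /lincomb !scalerBr !scalerDl !scalerA (mulrC al) (mulrC be).
  by apply/rowP => i; rewrite !mxE; ring.
rewrite rpredDr; last by rewrite rpredD ?rpredZ.
by rewrite rpredZeq (negPf uL) orbF.
Qed.

(** * Equations of lines in adapted coordinates *)

Definition af_form (R : realType) (M : marked_conic R) (F : adapted_frame M)
    (a b c : R) : 'Hom('rV[R]_3, R^o) :=
  a *: af_x F + b *: af_y F + c *: af_z F.

Lemma af_formE (R : realType) (M : marked_conic R) (F : adapted_frame M)
    (a b c x y z : R) :
  af_form F a b c (af_vec F x y z) = a * x + b * y + c * z.
Proof.
rewrite /af_form !add_lfunE !scale_lfunE.
by have [-> -> ->] := af_vecK F x y z.
Qed.

Lemma af_vec_inj (R : realType) (M : marked_conic R) (F : adapted_frame M)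
    (x y z x' y' z' : R) :
  af_vec F x y z = af_vec F x' y' z' -> [/\ x = x', y = y' & z = z'].
Proof.
have [hx hy hz] := af_vecK F x y z; have [hx' hy' hz'] := af_vecK F x' y' z'.
by move=> e; split; [rewrite -hx e|rewrite -hy e|rewrite -hz e].
Qed.

Lemma mem_lker_form (R : realType) (M : marked_conic R) (F : adapted_frame M)
    (a b c x y z : R) :
  (af_vec F x y z \in lker (af_form F a b c)) = (a * x + b * y + c * z == 0).
Proof. by rewrite memv_ker af_formE. Qed.

Lemma dim_lker_form (R : realType) (M : marked_conic R) (F : adapted_frame M)
    (a b c : R) :
  [|| a != 0, b != 0 | c != 0] -> \dim (lker (af_form F a b c)) = 2%N.
Proof.
case/or3P => h.
- by apply: (@dim_lker _ _ (af_vec F 1 0 0)); rewrite af_formE !mulr0 mulr1 !addr0.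
- apply: (@dim_lker _ _ (af_vec F 0 1 0)).
  by rewrite af_formE !mulr0 mulr1 addr0 add0r.
- by apply: (@dim_lker _ _ (af_vec F 0 0 1)); rewrite af_formE !mulr0 mulr1 !add0r.
Qed.

Lemma sub_lker_form (R : realType) (M : marked_conic R) (F : adapted_frame M)
    (U : {vspace 'rV[R]_3}) (a b c : R) :
  (forall x y z, af_vec F x y z \in U -> a * x + b * y + c * z = 0) ->
  (U <= lker (af_form F a b c))%VS.
Proof.
move=> h; apply/subvP => v; rewrite -(af_coordK F v) => vU.
by rewrite mem_lker_form h.
Qed.

Lemma conic_form_frame (R : realType) (M : marked_conic R)
    (F : adapted_frame M) (x y z : R) :
  conic_form (mc_conic M) (af_vec F x y z) = 2 * af_d F * (y ^+ 2 - x * z).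
Proof. by rewrite /conic_form af_bilinE; ring. Qed.

Lemma af_vecZ (R : realType) (M : marked_conic R) (F : adapted_frame M)
    (k x y z : R) :
  k *: af_vec F x y z = af_vec F (k * x) (k * y) (k * z).
Proof. by rewrite /af_vec /lincomb !scalerDr !scalerA. Qed.

Lemma af_vecD (R : realType) (M : marked_conic R) (F : adapted_frame M)
    (x y z x' y' z' : R) :
  af_vec F x y z + af_vec F x' y' z' = af_vec F (x + x') (y + y') (z + z').
Proof. by apply/rowP => i; rewrite !mxE; ring. Qed.

Lemma af_vec_base (R : realType) (M : marked_conic R) (F : adapted_frame M) :
  af_vec F 1 0 0 = af_u F.
Proof. by rewrite /af_vec /lincomb scale1r !scale0r !addr0. Qed.

(** * The quadratic algebra K[xi] / (xi^2 - al xi + be) *)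

(** The pair (s, t) stands for s + t xi. *)
Definition quad_mul (K : comNzRingType) (al be : K) (q r : K * K) : K * K :=
  (q.1 * r.1 - be * (q.2 * r.2),
   q.1 * r.2 + q.2 * r.1 + al * (q.2 * r.2)).

(** The conjugate of xi is al - xi, the other root of the equation of xi. *)
Definition quad_conj (K : comNzRingType) (al : K) (q : K * K) : K * K :=
  (q.1 + al * q.2, - q.2).

Definition quad_norm (K : comNzRingType) (al be : K) (q : K * K) : K :=
  q.1 ^+ 2 + al * (q.1 * q.2) + be * q.2 ^+ 2.

Lemma quad_mulA (K : comNzRingType) (al be : K) : associative (quad_mul al be).
Proof. by move=> q r s; congr pair => /=; ring. Qed.

Lemma quad_mulC (K : comNzRingType) (al be : K) : commutative (quad_mul al be).
Proof. by move=> q r; congr pair => /=; ring. Qed.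

Lemma quad_mul1 (K : comNzRingType) (al be : K) :
  left_id (1, 0) (quad_mul al be).
Proof. by case=> s t; congr pair => /=; ring. Qed.

Lemma quad_mul_conj (K : comNzRingType) (al be : K) q :
  quad_mul al be (quad_conj al q) q = (quad_norm al be q, 0).
Proof. by congr pair; rewrite /quad_norm /=; ring. Qed.

Lemma quad_normM (K : comNzRingType) (al be : K) q r :
  quad_norm al be (quad_mul al be q r) = quad_norm al be q * quad_norm al be r.
Proof. by rewrite /quad_norm /=; ring. Qed.

Lemma quad_norm_conj (K : comNzRingType) (al be : K) q :
  quad_norm al be (quad_conj al q) = quad_norm al be q.
Proof. by rewrite /quad_norm /=; ring. Qed.

Lemma quad_norm_scalar (K : comNzRingType) (al be k : K) :
  quad_norm al be (k, 0) = k ^+ 2.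
Proof. by rewrite /quad_norm /=; ring. Qed.

Lemma sum_squares_neq0 (K : realDomainType) (al be : K) q :
  quad_norm al be q != 0 -> q.1 ^+ 2 + q.2 ^+ 2 != 0.
Proof.
apply: contra; rewrite paddr_eq0 ?sqr_ge0 // !expf_eq0 /=.
move=> /andP[/eqP h1 /eqP h2].
by rewrite /quad_norm h1 h2; apply/eqP; ring.
Qed.

Local Notation alg_mul F := (quad_mul (af_alpha F) (af_beta F)).
Local Notation alg_conj F := (quad_conj (af_alpha F)).
Local Notation alg_norm F := (quad_norm (af_alpha F) (af_beta F)).

(** * The parametrization of the conic *)

Definition param (R : realType) (M : marked_conic R) (F : adapted_frame M)
    (q : R * R) : 'rV[R]_3 :=
  af_vec F (q.1 ^+ 2) (q.1 * q.2) (q.2 ^+ 2).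

(** The point a is the image of the parameter q under the parametrization.  The
condition on the norm keeps a off the line and q away from (0, 0). *)
Definition represents (R : realType) (M : marked_conic R)
    (F : adapted_frame M) (q : R * R) (a : point R) : Prop :=
  alg_norm F q != 0 /\ point_space a = <[param F q]>%VS.

Lemma param_line (R : realType) (M : marked_conic R) (F : adapted_frame M) q :
  (param F q \in line_space (mc_line M)) = (alg_norm F q == 0).
Proof. exact: af_lineE. Qed.

Lemma param_neq0 (R : realType) (M : marked_conic R) (F : adapted_frame M) q :
  alg_norm F q != 0 -> param F q != 0.
Proof. by rewrite -param_line; apply: contra => /eqP ->; exact: mem0v. Qed.

Lemma represents_inj (R : realType) (M : marked_conic R)
    (F : adapted_frame M) q (a b : point R) :
  represents F q a -> represents F q b -> a = b.
Proof. by case=> _ ea [_ eb]; apply: point_inj; rewrite ea eb. Qed.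

(** The parametrization is homogeneous of degree 2.  The factor between the two
vectors is written as a quotient of sums of squares, which avoids distinguishing
which component of q vanishes. *)
Lemma represents_proportional (R : realType) (M : marked_conic R)
    (F : adapted_frame M) q r (a : point R) :
  represents F q a -> alg_norm F r != 0 -> q.1 * r.2 = q.2 * r.1 ->
  represents F r a.
Proof.
case=> q0 qa r0 qr; split=> //; apply: point_span (param_neq0 r0).
have n0 := sum_squares_neq0 q0.
rewrite qa; apply/vlineP; exists ((r.1 ^+ 2 + r.2 ^+ 2) / (q.1 ^+ 2 + q.2 ^+ 2)).
apply: (scalerI n0); rewrite scalerA mulrC divfK // /param !af_vecZ.
by congr af_vec; ring: qr.
Qed.

(** On y^2 = x z, a point with z nonzero is the image of (y, z); the only point
with z = 0 is the base point, the image of (1, 0). *)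
Lemma represented (R : realType) (M : marked_conic R) (F : adapted_frame M)
    (a : XL M) : exists q, represents F q (val a).
Proof.
have := valP a; rewrite inE => -[aX aL].
have [v v0 va] := point_gen (val a).
have {}aX : conic_form (mc_conic M) v = 0 by apply: aX; rewrite va memv_line.
suff [q qa] : exists q, param F q \in point_space (val a) /\ param F q != 0.
  exists q; split; last exact: point_span qa.1 qa.2.
  rewrite -param_line; apply/negP => h; apply: aL.
  by rewrite /= /on_line (point_span qa.1 qa.2) -memvE.
move: aX; rewrite -(af_coordK F v) conic_form_frame => /eqP.
rewrite !mulf_eq0 pnatr_eq0 (negPf (af_d_neq0 F)) /= subr_eq0 => /eqP aX.
have [z0|z0] := eqVneq (af_z F v) 0.
  exists (1, 0); move/eqP: aX; rewrite z0 mulr0 expf_eq0 /= => /eqP y0.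
  have vE : v = (af_x F v : R) *: param F (1, 0).
    by rewrite -{1}(af_coordK F v) y0 z0 /param af_vecZ /=; congr af_vec; ring.
  have x0 : af_x F v != 0 by apply: contra v0 => /eqP x0; rewrite vE x0 scale0r.
  split; last by apply: contra v0; rewrite vE => /eqP ->; rewrite scaler0.
  rewrite va; apply/vlineP; exists (af_x F v : R)^-1.
  by rewrite {2}vE scalerA mulVf ?scale1r.
have pE : param F (af_y F v, af_z F v) = (af_z F v : R) *: v.
  rewrite -[X in _ *: X](af_coordK F v) af_vecZ /param /=.
  by rewrite aX; congr af_vec; ring.
exists (af_y F v, af_z F v); rewrite pE scaler_eq0 negb_or z0 v0; split=> //.
by rewrite va; apply/vlineP; exists (af_z F v).
Qed.

Lemma representing (R : realType) (M : marked_conic R) (F : adapted_frame M)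
    q : alg_norm F q != 0 -> exists a : XL M, represents F q (val a).
Proof.
move=> q0.
have d1 : \dim <[param F q]>%VS == 1%N by rewrite dim_vline param_neq0.
have aXL : Point d1 \in XL M.
  rewrite inE; split.
    move=> _ /vlineP[k ->]; rewrite /param af_vecZ conic_form_frame.
    by ring.
  by apply/negP; rewrite /on_line /= -memvE param_line.
by exists (SigSub aXL).
Qed.

Lemma represents_base (R : realType) (M : marked_conic R)
    (F : adapted_frame M) k :
  k != 0 -> represents F (k, 0) (mc_base M).
Proof.
move=> k0; have n0 : alg_norm F (k, 0) != 0 by rewrite quad_norm_scalar expf_neq0.
split=> //; apply: point_span (param_neq0 n0).
rewrite (af_baseE F); apply/vlineP; exists (k ^+ 2).
by rewrite -af_vec_base af_vecZ /param; congr af_vec; rewrite /=; ring.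
Qed.

(** * Chords *)

(** The quadratic form that the equation below pulls back to along the
parametrization has the roots q and r; for q = r the root is double and the line
is the tangent. *)
Definition chord_space (R : realType) (M : marked_conic R)
    (F : adapted_frame M) (q r : R * R) : {vspace 'rV[R]_3} :=
  lker (af_form F (q.2 * r.2) (- (q.1 * r.2 + q.2 * r.1)) (q.1 * r.1)).

Lemma dim_chord_space (R : realType) (M : marked_conic R)
    (F : adapted_frame M) q r :
  alg_norm F q != 0 -> alg_norm F r != 0 -> \dim (chord_space F q r) = 2%N.
Proof.
move=> q0 r0; apply: dim_lker_form.
have := mulf_neq0 q0 r0; rewrite -quad_normM; apply: contraR.
rewrite !negb_or !negbK oppr_eq0 => /and3P[/eqP T0 /eqP S0 /eqP P0].
by rewrite /quad_norm /= T0 S0 P0; apply/eqP; ring.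
Qed.

Lemma chord_spaceC (R : realType) (M : marked_conic R)
    (F : adapted_frame M) q r : chord_space F q r = chord_space F r q.
Proof.
rewrite /chord_space (mulrC q.2 r.2) (mulrC q.1 r.1) addrC.
by rewrite (mulrC q.2) (mulrC q.1 r.2).
Qed.

Lemma param_chord (R : realType) (M : marked_conic R) (F : adapted_frame M)
    q r (a : point R) :
  represents F q a -> (a <= chord_space F q r)%VS.
Proof.
case=> _ ->; rewrite -memvE mem_lker_form; apply/eqP; ring.
Qed.

(** The line chord_space contains both points, which settles the case of
distinct points.  If a = b, then r is a multiple of q, and the bilinear form at
param F q is a multiple of the linear form defining chord_space. *)
Lemma chordP (R : realType) (M : marked_conic R) (F : adapted_frame M)
    q r (a b : point R) (l : line R) :
    represents F q a -> represents F r b ->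
  chord (mc_conic M) a b l <-> line_space l = chord_space F q r.
Proof.
move=> qa rb; have dimC := dim_chord_space qa.1 rb.1.
rewrite /chord; case: eqVneq => [ab|ab]; last first.
  have abC : (a + b)%VS = chord_space F q r.
    apply/eqP; rewrite eqEdim dim_join // dimC subv_add (param_chord _ qa).
    by rewrite chord_spaceC (param_chord _ rb).
  by rewrite abC; split.
have param_ab : exists k, param F r = k *: param F q.
  by apply/vlineP; rewrite -qa.2 ab rb.2 memv_line.
have [c [r1 r2]] : exists c, r.1 = c * q.1 /\ r.2 = c * q.2.
  (* The square of the wedge of q and r vanishes: it only involves the entries
     of param F q and param F r, which are proportional. *)
  have wedge : q.1 * r.2 = q.2 * r.1.
    have [k] := param_ab; rewrite /param af_vecZ => e.
    have [e11 e12 e22] := af_vec_inj e.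
    apply/eqP; rewrite -subr_eq0 -sqrf_eq0; apply/eqP.
    transitivity (q.1 ^+ 2 * r.2 ^+ 2 - 2 * (q.1 * q.2) * (r.1 * r.2)
                  + q.2 ^+ 2 * r.1 ^+ 2); first by ring.
    by rewrite e11 e12 e22; ring.
  have n0 := sum_squares_neq0 qa.1.
  exists ((q.1 * r.1 + q.2 * r.2) / (q.1 ^+ 2 + q.2 ^+ 2)).
  by split; apply: (mulfI n0); rewrite mulrA (mulrC (_ + _)) (mulrC _ (_ / _));
    rewrite divfK //; ring: wedge.
have c0 : c != 0.
  by apply: contra rb.1 => /eqP c0; rewrite /quad_norm r1 r2 c0; apply/eqP; ring.
have bilinE x y z k : conic_bilin (mc_conic M) (k *: param F q) (af_vec F x y z)
    = - (k * af_d F / c) *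
      (q.2 * r.2 * x - (q.1 * r.2 + q.2 * r.1) * y + q.1 * r.1 * z).
  by rewrite /param af_vecZ af_bilinE r1 r2; field.
split=> [tg|lE u v].
  apply/eqP; rewrite eqEdim dimC dim_line andbT.
  apply: sub_lker_form => x y z vl; apply/eqP.
  have qa1 : 1 *: param F q \in point_space a by rewrite qa.2 scale1r memv_line.
  have /eqP := tg _ _ qa1 vl; rewrite bilinE mul1r.
  rewrite mulf_eq0 oppr_eq0 !mulf_eq0 invr_eq0 (negPf c0) (negPf (af_d_neq0 F)) /=.
  by rewrite mulNr.
rewrite qa.2 lE => /vlineP[k ->]; rewrite -(af_coordK F v) mem_lker_form mulNr.
by move=> /eqP h; rewrite bilinE h mulr0.
Qed.

Lemma mem_base_chord (R : realType) (M : marked_conic R)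
    (F : adapted_frame M) r x y z :
  (af_vec F x y z \in chord_space F (1, 0) r) = (r.1 * z == r.2 * y).
Proof.
by rewrite mem_lker_form -[RHS]subr_eq0; congr (_ == _); rewrite /=; ring.
Qed.

(** The equation of the chord of o and q r is that of the chord of q and r minus
q.2 r.2 times that of L. *)
Lemma meet_line_base_chord (R : realType) (M : marked_conic R)
    (F : adapted_frame M) q r :
  (chord_space F q r :&: mc_line M <=
     chord_space F (1, 0)%R (alg_mul F q r))%VS.
Proof.
apply/subvP => v; rewrite -(af_coordK F v).
move: (af_x F v : R) (af_y F v : R) (af_z F v : R) => x y z.
rewrite memv_cap af_lineE => /andP[].
rewrite [_ \in chord_space F q r]mem_lker_form => /eqP h1 /eqP h2.
rewrite (mem_base_chord F (alg_mul F q r)); apply/eqP/subr0_eq; rewrite /=.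
transitivity
  (q.2 * r.2 * x + - (q.1 * r.2 + q.2 * r.1) * y + q.1 * r.1 * z
   - q.2 * r.2 * (x + af_alpha F * y + af_beta F * z)); first by ring.
by rewrite h1 h2 mulr0 subr0.
Qed.

(** The second intersection c satisfies the equation of the chord, so its
parameter is proportional to (1, 0) or to r.  If it is (1, 0), both linear forms
in the factorization of the quadratic form vanish at o, so that form does not
change along m when a multiple of u is added: m is the tangent at o, and r is
itself proportional to (1, 0). *)
Lemma second_meet (R : realType) (M : marked_conic R) (F : adapted_frame M)
    r (m : line R) (c : XL M) :
    alg_norm F r != 0 -> line_space m = chord_space F (1, 0) r ->
    meets_in (mc_conic M) m (mc_base M) (val c) ->
  represents F r (val c).
Proof.
move=> r0 mE [f [g [fg mf mg]]].
have [q qc] := represented F c.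
have : param F q \in (m :&: lker g)%VS by rewrite mg qc.2 memv_line.
rewrite memv_cap mE mem_base_chord => /andP[/eqP q_on_m].
rewrite memv_ker => /eqP gq.
have [t0|t0] := eqVneq q.2 0; last first.
  apply: represents_proportional qc r0 _.
  by apply: (mulfI t0); ring: q_on_m.
suff r20 : r.2 = 0.
  by apply: represents_proportional qc r0 _; rewrite t0 r20 mulr0 mul0r.
have vm : af_vec F 0 r.1 r.2 \in line_space m by rewrite mE mem_base_chord mulrC.
have um : param F q \in line_space m by rewrite mE mem_base_chord q_on_m.
have fq : f (param F q) = 0.
  apply/eqP; rewrite -memv_ker.
  suff : param F q \in (m :&: lker f)%VS by rewrite memv_cap => /andP[].
  rewrite mf (af_baseE F) -af_vec_base; apply/vlineP; exists (q.1 ^+ 2).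
  by rewrite af_vecZ /param t0; congr af_vec; ring.
have := fg _ (rpredD um vm).
rewrite (linearD f (param F q)) (linearD g (param F q)) /= fq gq !add0r -fg //.
rewrite /param af_vecD !conic_form_frame => /eqP.
rewrite -subr_eq0 t0 -mulrBr mulf_eq0 mulf_eq0 pnatr_eq0 (negPf (af_d_neq0 F)) /=.
have -> : (q.1 * 0 + r.1) ^+ 2 - (q.1 ^+ 2 + 0) * (0 ^+ 2 + r.2)
    - (r.1 ^+ 2 - 0 * r.2) = - (q.1 ^+ 2 * r.2) by ring.
rewrite oppr_eq0 mulf_eq0 => /orP[|/eqP //].
have := sum_squares_neq0 qc.1; rewrite t0 expr0n addr0 => q1.
by rewrite (negPf q1).
Qed.

(** On the chord, the vector (y, z) is the multiple of r by
(r.1 y + r.2 z) / n, and y^2 - x z is the product of this factor and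
r.1 y - r.2 x, where n = r.1^2 + r.2^2.  The factor vanishes at o, the other form
at c. *)
Lemma base_chord_meets (R : realType) (M : marked_conic R)
    (F : adapted_frame M) r (m : line R) (c : point R) :
    represents F r c -> line_space m = chord_space F (1, 0) r ->
  meets_in (mc_conic M) m (mc_base M) c.
Proof.
move=> rc mE; pose n := r.1 ^+ 2 + r.2 ^+ 2.
have n0 : n != 0 := sum_squares_neq0 rc.1.
have o1 : represents F (1, 0) (mc_base M) by apply: represents_base (oner_neq0 R).
have om : on_line (mc_base M) m by rewrite /on_line mE (param_chord _ o1).
have cm : on_line c m by rewrite /on_line mE chord_spaceC (param_chord _ rc).
have vm : af_vec F 0 r.1 r.2 \in line_space m by rewrite mE mem_base_chord mulrC.
exists (af_form F 0 (r.1 / n) (r.2 / n)).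
exists (af_form F (- (2 * af_d F * r.2)) (2 * af_d F * r.1) 0).
split.
- move=> v; rewrite -(af_coordK F v) mE mem_base_chord conic_form_frame !af_formE.
  move: (af_x F v : R) (af_y F v : R) (af_z F v : R) => x y z /eqP h.
  apply: (mulfI n0); rewrite mulrA.
  transitivity (2 * af_d F * (r.1 * y + r.2 * z) * (r.1 * y - r.2 * x)).
    by rewrite /n; ring: h.
  by field.
- apply: (meet_lker vm _ om).
    rewrite af_formE mul0r add0r mulrAC (mulrAC r.2) -!expr2 -mulrDl divff //.
    exact: oner_neq0.
  rewrite (af_baseE F) -af_vec_base -memvE mem_lker_form; apply/eqP; ring.
have c_g : (c <= lker (af_form F (- (2 * af_d F * r.2)) (2 * af_d F * r.1) 0))%VS.
  by rewrite rc.2 -memvE mem_lker_form; apply/eqP; ring.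
have d2 : 2 * af_d F != 0 by rewrite mulf_neq0 ?pnatr_eq0 ?af_d_neq0.
(* A vector of m off the zero set of the second form: u itself, unless c = o. *)
have [r20|r20] := eqVneq r.2 0.
  apply: (meet_lker vm _ cm c_g); rewrite af_formE r20.
  rewrite mulr0 add0r mulr0 addr0 -mulrA mulf_neq0 // -expr2.
  by move: n0; rewrite /n r20 expr0n addr0.
have um : af_vec F 1 0 0 \in line_space m by rewrite mE mem_base_chord !mulr0.
apply: (meet_lker um _ cm c_g); rewrite af_formE.
by rewrite mulr1 !mulr0 !addr0 oppr_eq0 mulf_neq0.
Qed.

(** * The induced operation *)

(** The point p of the definition lies on the chord of o and q r by
meet_line_base_chord, so the line through o and p is that chord. *)
Lemma induced_sumP (R : realType) (M : marked_conic R) (F : adapted_frame M)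
    q r (a b c : XL M) :
    represents F q (val a) -> represents F r (val b) ->
  induced_sum a b c <-> represents F (alg_mul F q r) (val c).
Proof.
move=> qa rb.
have n0 : alg_norm F (alg_mul F q r) != 0.
  by rewrite quad_normM mulf_neq0 ?qa.1 ?rb.1.
have o1 : represents F (1, 0) (mc_base M) by apply: represents_base (oner_neq0 R).
have join_base (p : point R) (m : line R) (l : line R) :
    line_space l = chord_space F q r -> (l :&: mc_line M)%VS = p ->
    (mc_base M + p)%VS = m ->
    line_space m = chord_space F (1, 0) (alg_mul F q r).
  move=> lE lp pm; apply/eqP; rewrite eqEdim dim_line dim_chord_space ?o1.1 // andbT.
  rewrite -pm subv_add (param_chord _ o1) /= -lp lE.
  exact: meet_line_base_chord.
split.
  case=> l [m [p [ch lp pm mt]]].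
  have lE := (chordP l qa rb).1 ch.
  exact: second_meet n0 (join_base _ _ _ lE lp pm) mt.
move=> sc.
have dl : \dim (chord_space F q r) == 2%N by rewrite dim_chord_space ?qa.1 ?rb.1.
pose l := Line dl.
have lL : l != mc_line M.
  apply: contra qa.1 => /eqP e; rewrite -param_line -e /=.
  by rewrite memvE -qa.2 (param_chord _ qa).
have dp : \dim (l :&: mc_line M) == 1%N by rewrite meet_lines.
pose p := Point dp.
have op : mc_base M != p.
  apply: contra o1.1 => /eqP e; rewrite -param_line memvE -o1.2 e /=.
  exact: capvSr.
have dm : \dim (mc_base M + p) == 2%N by rewrite dim_join.
exists l, (Line dm), p; split=> //; first exact/(chordP l qa rb).
by apply: base_chord_meets sc _; apply: (join_base p _ l).
Qed.

Lemma induced_sum_functional (R : realType) (M : marked_conic R) (a b : XL M) :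
  exists c, forall c', induced_sum a b c' <-> c' = c.
Proof.
have [F] := exists_adapted_frame M.
have [q qa] := represented F a; have [r rb] := represented F b.
have [c qrc] : exists c : XL M, represents F (alg_mul F q r) (val c).
  by apply: representing; rewrite quad_normM mulf_neq0 ?qa.1 ?rb.1.
exists c => c'; rewrite (induced_sumP _ qa rb); split=> [qrc'|-> //].
exact/val_inj/(represents_inj qrc' qrc).
Qed.

Lemma oplusP (R : realType) (M : marked_conic R) (a b c : XL M) :
  induced_sum a b c <-> oplus a b = c.
Proof.
have [d dP] := induced_sum_functional a b.
have -> : oplus a b = d.
  apply/dP; apply: (@xgetPex _ _ [set c | induced_sum a b c]%classic).
  by exists d; apply/dP.
by rewrite dP; split=> ->.
Qed.

Lemma represents_oplus (R : realType) (M : marked_conic R)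
    (F : adapted_frame M) q r (a b : XL M) :
  represents F q (val a) -> represents F r (val b) ->
  represents F (alg_mul F q r) (val (oplus a b)).
Proof. by move=> qa rb; apply/(induced_sumP _ qa rb)/oplusP. Qed.

Theorem mainTheorem3 (R : realType) (M : marked_conic R) :
  (forall a b c : XL M, induced_sum a b c <-> oplus a b = c) /\
  is_group (@oplus R M) (base_pt M).
Proof.
split; first exact: oplusP.
have [F] := exists_adapted_frame M.
have o1 : represents F (1, 0) (val (base_pt M)).
  exact: represents_base (oner_neq0 R).
have oplusC (a b : XL M) : oplus a b = oplus b a.
  have [q qa] := represented F a; have [r rb] := represented F b.
  apply/val_inj/(represents_inj (represents_oplus qa rb)).
  by rewrite quad_mulC; apply: represents_oplus.
have oplus0 (a : XL M) : oplus (base_pt M) a = a.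
  have [q qa] := represented F a.
  apply/val_inj/(represents_inj (represents_oplus o1 qa)).
  by rewrite quad_mul1.
have has_inverse (a : XL M) : exists b : XL M, oplus b a = base_pt M.
  have [q qa] := represented F a.
  have [b qb] : exists b : XL M, represents F (alg_conj F q) (val b).
    by apply: representing; rewrite quad_norm_conj qa.1.
  exists b; apply/val_inj/(represents_inj (represents_oplus qb qa)).
  by rewrite quad_mul_conj; apply: represents_base; exact: qa.1.
have [inv invP] := boolp.choice has_inverse.
split=> //.
- move=> a b c; have [q qa] := represented F a.
  have [r rb] := represented F b; have [s sc] := represented F c.
  have rbc := represents_oplus rb sc; have qab := represents_oplus qa rb.
  apply/val_inj/(represents_inj (represents_oplus qa rbc)).
  by rewrite quad_mulA; apply: represents_oplus.
- by move=> a; rewrite oplusC.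
- by exists inv; split=> a //; rewrite oplusC.
Qed.
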